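(* Let $I\subset S=K[x_1,\dots,x_n]$ be a monomial complete intersection minimally generated by $m$ elements (that is, $I$ is generated by a regular sequence of $m$ monomials), and let $Z_p$, $p\ge0$, be the $p$-th syzygy module of $S/I$. Then either $Z_p$ is free or $$\operatorname{sdepth} Z_p\ge n-\left\lfloor\frac{m-p}{2}\right\rfloor.$$
   Context: $K$ is a field and $S=K[x_1,\dots,x_n]$ with its standard $\mathbb{Z}^n$-grading. Syzygy modules: let $\cdots\to F_1\to F_0=S\to S/I\to0$ be the minimal $\mathbb{Z}^n$-graded free resolution of $S/I$ (here the Koszul complex on the minimal monomial generators of $I$). Then $Z_0=\ker(F_0\to S/I)=I$ and $Z_p=\ker(F_p\to F_{p-1})$ for $p\ge1$. The zero module is free. Stanley depth: a Stanley decomposition of a finitely generated $\mathbb{Z}^n$-graded $S$-module $N$ is a finite direct sum decomposition $N=\bigoplus_{i=1}^r u_iK[Z_i]$ as a $\mathbb{Z}^n$-graded $K$-vector space, where each $u_i\in N$ is a homogeneous element, $Z_i\subseteq\{x_1,\dots,x_n\}$ is a set of variables (here $Z_i$ does not denote a syzygy module), and $u_iK[Z_i]$ is a free $K[Z_i]$-submodule of $N$. The Stanley depth of the decomposition is $\min_i|Z_i|$, and $\operatorname{sdepth} N$ is the maximum of the Stanley depths of its Stanley decompositions. *)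

(* Defs.v *)
From mathcomp Require Import all_boot all_order all_algebra.
From mathcomp Require Import mpoly.
From mathcomp Require Import boolp.
Set Implicit Arguments.
Unset Strict Implicit.
Unset Printing Implicit Defensive.
Import GRing.Theory.
Local Open Scope ring_scope.

Definition generated (R : comNzRingType) (m : nat) (P : pred 'I_m)
    (a : 'I_m -> R) (f : R) : Prop :=
  exists c : 'I_m -> R, f = \sum_(i | P i) c i * a i.

Definition regular_sequence (R : comNzRingType) (m : nat) (a : 'I_m -> R) :
    Prop :=
  (forall (i : 'I_m) (f : R),
     generated (fun j => j < i)%N a (a i * f) ->
     generated (fun j => j < i)%N a f)
  /\ ~ generated predT a 1.

Definition free_submodule (R : comNzRingType) (M : lmodType R)
    (N : M -> Prop) : Prop :=
  exists (r : nat) (b : 'I_r -> M),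
    (forall v : M, N v <-> exists c : 'I_r -> R, v = \sum_i c i *: b i)
    /\ (forall c : 'I_r -> R, \sum_i c i *: b i = 0 -> forall i, c i = 0).

Section StanleyDepth.

Variables (K : fieldType) (n : nat) (M : lmodType {mpoly K[n]}).

(* [homogeneous v] means that [v] is homogeneous for the multigrading of [M]. *)
Variable homogeneous : M -> Prop.

Definition in_vars (Z : {set 'I_n}) (g : {mpoly K[n]}) : Prop :=
  forall mm : 'X_{1..n}, mm \in msupp g -> forall j, j \notin Z -> mm j = 0%N.

Definition stanley_space (u : M) (Z : {set 'I_n}) (v : M) : Prop :=
  exists2 g : {mpoly K[n]}, in_vars Z g & v = g *: u.

Definition stanley_decomposition (N : M -> Prop) (r : nat)
    (u : 'I_r -> M) (Z : 'I_r -> {set 'I_n}) : Prop :=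
  [/\ forall i, N (u i) /\ homogeneous (u i),
      forall i (g : {mpoly K[n]}), in_vars (Z i) g -> g *: u i = 0 -> g = 0,
      forall v : M, N v <->
        exists2 w : 'I_r -> M,
          forall i, stanley_space (u i) (Z i) (w i) & v = \sum_i w i
    & forall w : 'I_r -> M,
        (forall i, stanley_space (u i) (Z i) (w i)) ->
        \sum_i w i = 0 -> forall i, w i = 0].

(* As #|Z i| <= n, the default value n only matters for r = 0, that is, for
   the empty decomposition of the zero module. *)
Definition stanley_depth (r : nat) (Z : 'I_r -> {set 'I_n}) : nat :=
  \big[minn/n]_(i < r) #|Z i|.

Definition sdepth (N : M -> Prop) : nat :=
  (\max_(d < n.+1 | `[< exists (r : nat) (u : 'I_r -> M)
                          (Z : 'I_r -> {set 'I_n}),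
       stanley_decomposition N u Z /\ stanley_depth Z = d >]) d)%N.

End StanleyDepth.

Section Koszul.

Variables (K : fieldType) (n m : nat) (u : 'I_m -> 'X_{1..n}).

(* All the modules F_p of the Koszul complex of the monomials 'X_[u j] are
   handled inside their direct sum, the free S-module with basis e_A for
   A : {set 'I_m}; [f A] is the coefficient of e_A in [f]. *)
Definition koszul : lmodType {mpoly K[n]} :=
  {ffun {set 'I_m} -> {mpoly K[n]}^o}.

Definition koszul_degree (p : nat) (f : koszul) : Prop :=
  forall A : {set 'I_m}, #|A| != p -> f A = 0.

(* Coordinate form of
   d e_A = \sum_(j in A) (-1)^#|{i in A | i < j}| 'X_[u j] e_(A :\ j). *)
Definition koszul_diff (f : koszul) : koszul :=
  [ffun B : {set 'I_m} =>
     \sum_(j | j \notin B)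
       ((-1) ^+ #|[set i in B | (i < j)%N]| * 'X_[K, u j]) *: f (j |: B)].

(* e_A has multidegree \sum_(j in A) u j. Hence the degrees in Z^n that occur
   all lie in N^n, and the zero element has every degree. *)
Definition koszul_homog (f : koszul) : Prop :=
  exists a : 'X_{1..n}, forall (A : {set 'I_m}) (mm : 'X_{1..n}),
    mm \in msupp (f A : {mpoly K[n]}) -> (mm + \sum_(j in A) u j)%MM = a.

(* The minimal free resolution of S/I is the Koszul complex. For p = 0 the map
   out of F_0 = S e_set0 is the augmentation S -> S/I. *)
Definition koszul_syzygy (p : nat) (f : koszul) : Prop :=
  koszul_degree p f /\
  if p is 0 then generated predT (fun j => 'X_[K, u j]) (f set0)
  else koszul_diff f = 0.

End Koszul.

(* Main.v *)
Require Import Defs.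
From mathcomp Require Import all_boot all_order all_algebra.
From mathcomp Require Import mpoly zify ring.
From mathcomp Require Import boolp.

(** Write [d] for the Koszul differential and [e_A] for the basis.  The proof
    exhibits an explicit Stanley decomposition of [Z_p] for [p <= m]; for
    [p > m] the module [Z_p] is zero, hence free.

    Triangularity.  Give a subset [A] of the index set the weight
    [\sum_(i in A) i].  Let [C] have [p] elements and let [c] be its least
    element ([c = m] if [C] is empty).  For [j < c] the coefficient of
    [d e_(j |: C)] at [e_C] is [u_j], and every other nonzero coefficient sits
    at a basis vector of smaller weight ([coef_generator_lower]).  Conversely,
    if [f] in [Z_p] has no coefficient of weight larger than that of [C], then
    the coefficient [f_C] lies in the ideal [J_C = (u_j : j < c)]: the
    coefficient of [d f] at [C :\ c] writes [u_c f_C] as an element of [J_C],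
    and [u] is a regular sequence ([syzygy_top_coef]); for [p = 0] the ideal
    [J_C] is [I] itself.  Hence [Z_p] is filtered with quotients the shifted
    ideals [J_C], where [c <= m - p], and Stanley decompositions of the [J_C]
    into spaces [v K[Z]] with [v] a monomial lift to a Stanley decomposition of
    [Z_p]: a monomial [v] in [J_C], divisible by [u_j], lifts to
    [(v / u_j) d e_(j |: C)].

    Monomial ideals.  It remains to decompose [J = (u_0, ..., u_(c-1))] into
    spaces [v K[Z]] with [#|Z| >= n - c./2].  Attach to a monomial [a] of [J]
    the set [T] of the [j < c] such that [u_j] divides [a].  The nonempty
    subsets of [{0, ..., c-1}] are partitioned into intervals, each of the form
    [{Y | Y and T agree on O_T}] with at most [c./2] elements in [O_T :\: T]
    ([selector_agree], [selector_count]).  The monomials whose set lies in such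
    an interval are those which [u_j] divides for [j] in [O_T :&: T] and does
    not divide for [j] in [O_T :\: T].  Each non-divisibility condition is
    split according to the first variable whose exponent is smaller than in
    [u_j]; freezing the exponent of that variable costs one variable.  The
    supports of the [u_j] are disjoint, so these splittings are independent.

    Interval partitions.  Let [b] be odd and place [0, ..., b-1] on a circle.
    A nonempty subset [T] is a circular word in which there is exactly one way
    to cut the circle into blocks that are either one letter in [T] or two
    letters of which the first is not in [T].  Let [O_T] be the set of first
    letters of blocks.  Changing [T] at second letters does not change the
    cutting, and [O_T :\: T] is the set of first letters of two-letter blocks,
    so it has at most [b./2] elements.  As [b] is odd, some block has one
    letter, so [O_T] meets [T] and the subsets agreeing with [T] on [O_T] are
    nonempty.  An even [c] is reduced to [c - 1]. *)

Set Implicit Arguments.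
Unset Strict Implicit.
Unset Printing Implicit Defensive.
Import Order.TTheory GRing.Theory.
Local Open Scope ring_scope.

(** * Interval partitions of the nonempty subsets of a finite set *)

Section Selector.
Local Open Scope nat_scope.
Implicit Types (x y o : nat -> bool) (b c i : nat).

(** Subsets of [nat] are boolean predicates [x].  [phase s x i] says that a
    block starts at [i] when the line [0, 1, ...] is cut into blocks from left
    to right, a block being one letter in [x] or two letters with the first one
    outside [x]; [s] tells whether a block starts at [0]. *)
Fixpoint phase (s : bool) x i : bool :=
  if i is k.+1 then ~~ phase s x k || x k else s.

(** Starts of the blocks when [0, ..., b-1] lie on a circle and [x] contains
    some [i < b].  Going once around the circle from either value of the initial
    state ends in the same state, and this state is the correct initial one. *)
Definition cycle_phase b x : nat -> bool := phase (phase true x b) x.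

(** The set [O_x] of positions at which membership in [x] is prescribed; the
    sets agreeing with [x] there form an interval.  For even [c = b.+1] the sets
    containing [b] form a single interval, and the other ones are handled by
    the circle of odd length [b]. *)
Definition selector c x i : bool :=
  if c is b.+1 then
    if ~~ odd b then (i < c) && cycle_phase c x i
    else (i == b) || [&& ~~ x b, i < b & cycle_phase b x i]
  else false.

Lemma phase_unique b x o :
    (forall i, i < b -> o i.+1 = ~~ o i || x i) ->
  forall i, i <= b -> o i = phase (o 0) x i.
Proof. by move=> ho; elim=> [|i IH] // ib; rewrite ho //= IH // ltnW. Qed.

(** A letter in [x] is always followed by the start of a block, whatever the
    initial state. *)
Lemma phase_sync b x i s t :
  i < b -> x i -> phase s x b = phase t x b.
Proof.
move=> ib xi; elim: b ib => // b IH; rewrite ltnS leq_eqVlt.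
by case/predU1P => [<-|/IH] /= => [|->] //; rewrite xi !orbT.
Qed.

Lemma cycle_phase_closed b x i :
  i < b -> x i -> cycle_phase b x b = cycle_phase b x 0.
Proof. by move=> ib xi; rewrite /cycle_phase /= (phase_sync _ true ib xi). Qed.

Lemma cycle_phase_unique b x o i :
    i < b -> x i ->
    (forall j, j < b -> o j.+1 = ~~ o j || x j) -> o b = o 0 ->
  forall j, j <= b -> o j = cycle_phase b x j.
Proof.
move=> ib xi ho o0 j jb; rewrite (phase_unique ho jb) /cycle_phase.
by rewrite -o0 (phase_unique ho (leqnn b)) (phase_sync _ true ib xi).
Qed.

(** Otherwise all blocks would have two letters, and [b] would be even. *)
Lemma cycle_phase_meets b x i :
  odd b -> i < b -> x i -> exists j, [&& j < b, cycle_phase b x j & x j].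
Proof.
move=> ob ib xi; have cl := cycle_phase_closed ib xi.
case: (boolP (has (fun j => cycle_phase b x j && x j) (iota 0 b))).
  by case/hasP => j; rewrite mem_iota /= add0n => jb ?; exists j; rewrite jb.
move/hasPn => h.
suff alt j : j <= b -> cycle_phase b x j = cycle_phase b x 0 (+) odd j.
  by move: (alt b (leqnn b)); rewrite cl ob addbT; case: (cycle_phase b x 0).
elim: j => [|j IH] jb; first by rewrite addbF.
move: (h j); rewrite mem_iota /= add0n jb => /(_ isT).
move: (IH (ltnW jb)); rewrite /cycle_phase /= => ->.
by case: (phase _ _ b); case: (odd j); case: (x j).
Qed.

Lemma cycle_phase_agree b x y :
    odd b -> (exists2 i, i < b & x i) ->
    (forall i, i < b -> cycle_phase b x i -> y i = x i) ->
  forall j, j <= b -> cycle_phase b y j = cycle_phase b x j.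
Proof.
move=> ob [i ib xi] yx j jb; have [k /and3P[kb ok xk]] := cycle_phase_meets ob ib xi.
apply/esym; apply: (@cycle_phase_unique _ _ _ k) jb => //; first by rewrite yx.
  move=> l lb; rewrite {1}/cycle_phase /= -/(cycle_phase b x l).
  by move: (yx l lb); case: (cycle_phase b x l) => //= ->.
exact: cycle_phase_closed ib xi.
Qed.

(** The start [j] of a two-letter block is followed by a position which is not a
    start, so there are at least as many non-starts as such [j]. *)
Lemma cycle_phase_count b x i :
  i < b -> x i -> \sum_(j < b) (cycle_phase b x j && ~~ x j) <= b./2.
Proof.
move=> ib xi; have cl := cycle_phase_closed ib xi.
set o := cycle_phase b x in cl *.
have e1 : \sum_(j < b) (o j && ~~ x j) = \sum_(j < b) ~~ o j.+1.
  by apply: eq_bigr => j _; rewrite /o /cycle_phase /= negb_or negbK.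
have e2 : \sum_(j < b) ~~ o j.+1 = \sum_(j < b) ~~ o j.
  have : \sum_(j < b.+1) ~~ o j = \sum_(j < b.+1) ~~ o j by [].
  by rewrite {1}big_ord_recl big_ord_recr /= cl addnC => /addIn <-.
have : \sum_(j < b) (o j && ~~ x j) + \sum_(j < b) ~~ o j <= \sum_(j < b) 1.
  by rewrite -big_split /=; apply: leq_sum => j _; case: (o j); case: (x j).
rewrite sum1_card card_ord -e2 -e1; lia.
Qed.

Let ltn_pred_in b x i : i < b.+1 -> x i -> ~~ x b -> i < b.
Proof. by rewrite ltnS leq_eqVlt => /predU1P[-> ->|]. Qed.

Lemma selector_lt c x i : selector c x i -> i < c.
Proof.
case: c => // b; rewrite /selector /=; case: ifP => _; first by case/andP.
by case/orP=> [/eqP-> //|/and3P[_ + _]]; lia.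
Qed.

Lemma selector_meets c x :
  (exists2 i, i < c & x i) -> exists i, selector c x i && x i.
Proof.
case: c => [|b] [i] // ib xi; rewrite /selector /=; case ob: (odd b); last first.
  have {}ob : odd b.+1 by rewrite /= ob.
  have [j /and3P[jb oj xj]] := cycle_phase_meets ob ib xi.
  by exists j; rewrite jb oj xj.
case: (boolP (x b)) => [xb|xb]; first by exists b; rewrite eqxx.
have {}ib := ltn_pred_in ib xi xb.
have [j /and3P[jb oj xj]] := cycle_phase_meets ob ib xi.
by exists j; rewrite jb oj xj orbT.
Qed.

Lemma selector_agree c x y :
    (exists2 i, i < c & x i) -> (forall i, selector c x i -> y i = x i) ->
  selector c y =1 selector c x.
Proof.
case: c => [|b] // [i ib xi] yx j; move: yx; rewrite /selector /=.
case ob: (odd b) => yx; last first.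
  have {}ob : odd b.+1 by rewrite /= ob.
  case: (ltnP j b.+1) => //= jb; apply: cycle_phase_agree (ltnW jb) => //.
    by exists i.
  by move=> k kb ok; apply: yx; rewrite kb ok.
have -> : y b = x b by apply: yx; rewrite eqxx.
case: (boolP (x b)) => //= xb.
have {}ib := ltn_pred_in ib xi xb.
case: (ltnP j b) => //= jb; congr (_ || _).
apply: cycle_phase_agree (ltnW jb) => //; first by exists i.
by move=> k kb ok; apply: yx; rewrite kb ok xb orbT.
Qed.

Lemma selector_count c x :
  (exists2 i, i < c & x i) -> \sum_(i < c) (selector c x i && ~~ x i) <= c./2.
Proof.
case: c => [[] // | b [i ib xi]]; rewrite /selector /=; case ob: (odd b); last first.
  have {}ob : odd b.+1 by rewrite /= ob.
  apply: leq_trans (cycle_phase_count ib xi); apply: leq_sum => j _.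
  by rewrite ltn_ord.
rewrite big_ord_recr /= eqxx /=.
case: (boolP (x b)) => [xb|xb].
  by rewrite big1 ?addn0 // => j _; rewrite orbF ltn_eqF.
have {}ib := ltn_pred_in ib xi xb.
have := cycle_phase_count ib xi.
rewrite (eq_bigr (fun j : 'I_b => nat_of_bool (cycle_phase b x j && ~~ x j))).
  by move: ob => /=; lia.
by move=> j _; rewrite ltn_ord ltn_eqF.
Qed.

End Selector.

(** * Ideals generated by monomials *)

Section MonomialIdeals.

Variables (K : fieldType) (n m : nat) (u : 'I_m -> 'X_{1..n}).

Lemma msupp_generated (P : pred 'I_m) (f : {mpoly K[n]}) (a : 'X_{1..n}) :
    generated P (fun j => 'X_[K, u j]) f -> a \in msupp f ->
  exists2 j, P j & (u j <= a)%MM.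
Proof.
case=> c ->; case: (boolP [exists j, P j && (u j <= a)%MM]).
  by case/existsP=> j /andP[]; exists j.
rewrite negb_exists => /forallP h; rewrite mcoeff_msupp raddf_sum big1 ?eqxx //=.
move=> j Pj; apply: memN_msupp_eq0; rewrite (perm_mem (msuppMX _ _)).
apply/mapP=> -[b _ ab]; move: (h j); rewrite Pj ab /=.
by case/negP; apply/mnm_lepP => i; rewrite mnmDE leq_addr.
Qed.

Lemma generated_mpolyX (P : pred 'I_m) (a : 'X_{1..n}) j :
  P j -> (u j <= a)%MM -> generated P (fun j => 'X_[K, u j]) 'X_[a].
Proof.
move=> Pj ja; exists (fun i => if i == j then 'X_[a - u j] else 0).
rewrite (bigD1 j) //= eqxx -mpolyXD submK // big1 ?addr0 //.
by move=> i /andP[_ /negPf->]; rewrite mul0r.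
Qed.

(** Monomials forming a regular sequence are pairwise coprime: if [u_i] and
    [u_j], [i < j], shared a variable, then [u_j] would multiply the monomial
    [u_i / gcd(u_i, u_j)] into [(u_i)], so some [u_k] with [k < j] would divide
    it, and this [u_k] would be coprime to [u_i] by induction on [j]. *)
Lemma regular_monomials_disjoint :
    regular_sequence (fun i : 'I_m => 'X_[K, u i]) ->
  forall x i j, u i x != 0%N -> u j x != 0%N -> i = j.
Proof.
case=> reg proper.
have unot0 k : u k != 0%MM.
  apply/eqP => uk0; apply: proper; rewrite -(mpolyX0 n K).
  by apply: (@generated_mpolyX _ _ k); rewrite // uk0 lepm_refl.
suff dis d x (i j : 'I_m) : (i < j < d)%N -> u i x != 0%N -> u j x = 0%N.
  move=> x i j ix jx; apply/val_inj/eqP; case: ltngtP => // ij.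
    by case/eqP: jx; apply: (dis m _ i); rewrite ?ij ?ltn_ord.
  by case/eqP: ix; apply: (dis m _ j); rewrite ?ij ?ltn_ord.
elim: d x i j => [|d IH] x i j; first by rewrite ltn0 andbF.
case/andP=> ij; rewrite ltnS => jd uix; apply/eqP/negPn/negP => ujx.
have := @reg j 'X_[u i - u j] _; rewrite -mpolyXD.
have hi : (u i <= u j + (u i - u j))%MM.
  by apply/mnm_lepP=> y; rewrite mnmDE mnmBE; lia.
move=> /(_ (@generated_mpolyX (fun k => k < j)%N _ i ij hi)).
have sX : (u i - u j)%MM \in msupp ('X_[u i - u j] : {mpoly K[n]}).
  by rewrite msuppX inE.
case/msupp_generated/(_ sX) => k kj /mnm_lepP le_k.
have ki : k != i.
  apply/eqP=> ki; have := le_k x; rewrite ki mnmBE.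
  by move: uix ujx; rewrite -!lt0n; lia.
case/eqP: (unot0 k); apply/mnmP => y; rewrite mnm0E.
apply/eqP/negPn/negP=> uky.
have : u i y != 0%N.
  by have := le_k y; rewrite mnmBE; move: uky; rewrite -!lt0n; lia.
move: uky; case: (ltngtP k i) => [lt|lt|/val_inj e].
- by move=> uky /eqP; apply; apply: IH uky; rewrite lt (leq_trans ij).
- by move=> /eqP nz uiy; apply: nz; apply: IH uiy; rewrite lt (leq_trans kj).
- by rewrite e eqxx in ki.
Qed.

End MonomialIdeals.

(** * Box decomposition of an ideal of coprime monomials *)

Section Boxes.

Local Open Scope nat_scope.
Variables (n m : nat) (u : 'I_m -> 'X_{1..n}) (c : nat).
Hypothesis u_disjoint : forall x i j, u i x != 0 -> u j x != 0 -> i = j.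
Hypothesis cm : c <= m.
Implicit Types (a b : 'X_{1..n}) (i j : 'I_m) (x y : 'I_n).

(** The set of the [k] such that [u_k] divides [a], as a predicate on [nat]. *)
Definition divisor_at a (k : nat) : bool :=
  oapp (fun j => u j <= a)%MM false (insub k).

(** Membership of the monomial [a] in the ideal [J] generated by the [u_j] with
    [j < c]. *)
Definition in_ideal a : bool := [exists j : 'I_m, (j < c) && (u j <= a)%MM].

Definition selected a : {set 'I_m} := [set j : 'I_m | selector c (divisor_at a) j].

(** All exponents of [u_j] before the variable [x] are reached by [a]. *)
Definition full_before a j x : bool :=
  [forall y : 'I_n, (y < x) ==> (u j y <= a y)].

(** Least monomial of the box containing [a].  The sum has at most one nonzero
    term, by coprimality: for a selected [u_j] with [u_j x != 0], the exponent
    at [x] is that of [u_j] before the first variable in which [a] falls short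
    of [u_j], that of [a] at this variable, and [0] after it. *)
Definition root a : 'X_{1..n} :=
  [multinom \sum_(j in selected a | full_before a j x) minn (a x) (u j x) | x < n].

(** The variables in which [a] first falls short of a selected [u_j].  They are
    constant on the box of [a]; all the other variables are free. *)
Definition frozen a : {set 'I_n} :=
  [set x | [exists j in selected a, full_before a j x && (a x < u j x)]].

Lemma divisor_atE a j : divisor_at a j = (u j <= a)%MM.
Proof. by rewrite /divisor_at valK. Qed.

Lemma in_idealP a :
  reflect (exists2 k, k < c & divisor_at a k) (in_ideal a).
Proof.
apply: (iffP existsP) => [[j /andP[jc ja]]|[k kc]].
  by exists j; rewrite ?divisor_atE.
rewrite /divisor_at; case: insubP => //= j _ jk ja.
by exists j; rewrite jk kc.
Qed.

Lemma rootE a j x : u j x != 0 ->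
  root a x = if (j \in selected a) && full_before a j x
             then minn (a x) (u j x) else 0.
Proof.
move=> ujx; rewrite mnmE big_mkcond (bigD1 j) //= big1 ?addn0 // => i ij.
case: ifP => // _; apply/eqP; rewrite -leqn0 geq_min orbC leqn0.
by apply/orP; left; apply: contraNT ij => uix; rewrite (u_disjoint uix ujx).
Qed.

Lemma root_eq0 a x : (forall j, u j x = 0) -> root a x = 0.
Proof. by move=> u0; rewrite mnmE big1 // => j _; rewrite u0 minn0. Qed.

Lemma root_le a : (root a <= a)%MM.
Proof.
apply/mnm_lepP => x; case: (pickP (fun j => u j x != 0)) => [j /rootE->|u0].
  by case: ifP => // _; rewrite geq_minl.
by rewrite root_eq0 // => j; apply/eqP/negbFE/u0.
Qed.

Lemma frozenP a x :
  reflect (exists2 j, j \in selected a & full_before a j x && (a x < u j x))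
          (x \in frozen a).
Proof.
rewrite inE; apply: (iffP existsP) => [[j /andP[]]|[j js h]]; first by exists j.
by exists j; rewrite js.
Qed.

Lemma root_frozen a x : x \in frozen a -> root a x = a x.
Proof.
case/frozenP=> j js /andP[fb lt]; have ujx : u j x != 0 by rewrite -lt0n; lia.
by rewrite (rootE _ ujx) js fb; apply/minn_idPl/ltnW.
Qed.

(** [b] lies in the box of [a]. *)
Definition in_box a b : bool :=
  (root a <= b)%MM && [forall x in frozen a, b x == root a x].

Lemma not_divisor_frozen a j : ~~ (u j <= a)%MM ->
  exists2 x, full_before a j x & a x < u j x.
Proof.
move=> nd; have : [exists x, a x < u j x].
  apply: contraR nd; rewrite negb_exists => /forallP h.
  by apply/mnm_lepP => x; rewrite leqNgt.
(* The first variable in which [a] falls short of [u_j]. *)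
case/existsP=> x0 h0; case: (@arg_minnP _ x0 (fun x => a x < u j x) val h0) => x lt hx.
exists x => //; apply/forallP => y; apply/implyP => yx.
by rewrite leqNgt; apply/negP => /hx; rewrite /= leqNgt yx.
Qed.

(** The box of a monomial of [J] is contained in [J], and each of its elements
    has the same box. *)
Section InBox.
Variables a b : 'X_{1..n}.
Hypotheses (aI : in_ideal a) (ab : in_box a b).

Let frozen_eq x : x \in frozen a -> b x = a x.
Proof.
move=> xf; case/andP: ab => _ /forall_inP/(_ _ xf)/eqP ->; exact: root_frozen.
Qed.

Let le_box x : root a x <= b x.
Proof. by case/andP: ab => /mnm_lepP. Qed.

Let box_ge j x : j \in selected a -> full_before a j x -> u j x <= a x ->
  u j x <= b x.
Proof.
move=> js fb le; have [->//|ujx] := eqVneq (u j x) 0.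
by have := le_box x; rewrite (rootE _ ujx) js fb (minn_idPr le).
Qed.

Let box_divisor j : j \in selected a -> (u j <= b)%MM = (u j <= a)%MM.
Proof.
move=> js; case: (boolP (u j <= a)%MM) => [/mnm_lepP le|/not_divisor_frozen].
  apply/mnm_lepP => x; apply: box_ge => //.
  by apply/forallP => y; rewrite le implybT.
case=> x fb lt; apply/negbTE/negP => /mnm_lepP/(_ x).
rewrite leqNgt frozen_eq ?lt //; apply/frozenP; exists j => //.
by rewrite fb.
Qed.

Lemma box_selected : selected b = selected a.
Proof.
apply/setP => j; rewrite !inE; apply: selector_agree; first exact/in_idealP.
move=> k kS; have km : k < m by apply: leq_trans cm; apply: selector_lt kS.
have -> : k = Ordinal km by [].
by rewrite !divisor_atE; apply: box_divisor; rewrite inE.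
Qed.

Let box_full j x : j \in selected a -> full_before b j x = full_before a j x.
Proof.
move=> js; apply/idP/idP => /forallP h.
  apply/negPn/negP => nf.
  (* The first variable in which [a] falls short of [u_j] is frozen, so [b]
     falls short there as well. *)
  have : [exists y : 'I_n, (y < x) && (a y < u j y)].
    move: nf; rewrite negb_forall => /existsP[y]; rewrite negb_imply -ltnNge.
    by move=> ?; apply/existsP; exists y.
  case/existsP=> x0 h0.
  case: (@arg_minnP _ x0 (fun y : 'I_n => (y < x) && (a y < u j y)) val h0).
  move=> y /andP[yx lt] hy.
  have yf : y \in frozen a.
    apply/frozenP; exists j => //; rewrite lt andbT; apply/forallP => z.
    apply/implyP => zy; rewrite leqNgt; apply/negP => ltz.
    by have := hy z; rewrite ltz (ltn_trans zy yx) /= leqNgt zy => /(_ isT).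
  by have := h y; rewrite yx leqNgt frozen_eq // lt.
apply/forallP => y; apply/implyP => yx; apply: box_ge => //.
  by apply/forallP=> z; apply/implyP=> zy; apply: (implyP (h z)); apply: ltn_trans zy yx.
exact: (implyP (h y)).
Qed.

Let box_lt j x : j \in selected a -> full_before a j x ->
  (b x < u j x) = (a x < u j x).
Proof.
move=> js fb; case: (ltnP (a x) (u j x)) => h; last by rewrite ltnNge box_ge.
by rewrite frozen_eq //; apply/frozenP; exists j; rewrite // fb h.
Qed.

Lemma box_root : root b = root a.
Proof.
apply/mnmP => x; case: (pickP (fun j => u j x != 0)) => [j ujx|u0]; last first.
  by rewrite !root_eq0 // => j; apply/eqP/negbFE/u0.
rewrite !(rootE _ ujx) box_selected; case: (boolP (j \in _)) => //= js.
rewrite box_full //; case: ifP => // fb.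
case: (ltnP (a x) (u j x)) => lt.
  have -> : b x = a x.
    by apply: frozen_eq; apply/frozenP; exists j; rewrite // fb lt.
  exact/minn_idPl/ltnW.
exact/minn_idPr/box_ge.
Qed.

Lemma box_frozen : frozen b = frozen a.
Proof.
apply/setP => x; apply/frozenP/frozenP; rewrite box_selected => -[j js].
  by rewrite box_full // => /andP[fb]; rewrite box_lt // => lt; exists j; rewrite // fb.
by case/andP=> fb lt; exists j => //; rewrite box_full // fb box_lt.
Qed.

Lemma box_ideal : in_ideal b.
Proof.
have [k /andP[kS ka]] := selector_meets (in_idealP _ aI).
have kc := selector_lt kS; have km := leq_trans kc cm.
have ek : k = Ordinal km by [].
apply/existsP; exists (Ordinal km); rewrite kc /=.
by rewrite box_divisor -?divisor_atE // inE.
Qed.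

End InBox.

Lemma root_in_box a : in_box a (root a).
Proof. by rewrite /in_box lepm_refl; apply/forall_inP. Qed.

Lemma frozen_count a : in_ideal a -> #|frozen a| <= c./2.
Proof.
move=> /in_idealP aI; apply: leq_trans (selector_count aI).
pose E := [set k : 'I_c | selector c (divisor_at a) k && ~~ divisor_at a k].
have -> : \sum_(k < c) (selector c (divisor_at a) k && ~~ divisor_at a k) = #|E|.
  rewrite -sum1_card [RHS]big_mkcond; apply: eq_bigr => k _.
  by rewrite inE; case: (_ && _).
(* A frozen variable [x] determines a selected non-divisor [u_j], and [x] is
   determined by [j] as the first variable where [a] falls short of [u_j]. *)
pose viol x j := [&& j \in selected a, full_before a j x & a x < u j x].
have -> : #|frozen a| = #|[set [pick j | viol x j] | x in frozen a]|.
  apply/esym/card_in_imset => x y xf _ /=.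
  case: pickP => [j /and3P[_ fx lx]|none]; last first.
    case/frozenP: xf => j js h; by have := none j; rewrite /viol js h.
  case: pickP => // i /and3P[_ fy ly] [ji]; rewrite -{i}ji in fy ly.
  apply/val_inj/eqP; case: ltngtP => // lt.
    by have := forallP fy x; rewrite lt leqNgt lx.
  by have := forallP fx y; rewrite lt leqNgt ly.
apply: leq_trans (leq_imset_card (fun k : 'I_c => Some (widen_ord cm k)) _).
apply/subset_leq_card/subsetP => _ /imsetP[x /frozenP[j0 js0 h0] ->].
case: pickP => [j /and3P[js fx lx]|none]; last by have := none j0; rewrite /viol js0 h0.
have jc : j < c by move: js; rewrite inE => /selector_lt.
apply/imsetP; exists (Ordinal jc); last by congr Some; apply/val_inj.
move: js; rewrite !inE /= => ->; rewrite divisor_atE.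
by apply/negP => /mnm_lepP/(_ x); rewrite leqNgt lx.
Qed.

(** A strict bound on the degrees of the roots, which are therefore finite in
    number: at [x], a root has exponent at most [\sum_j u_j x]. *)
Definition root_bound : nat := (\sum_(x < n) \sum_(j < m) u j x).+1.

Lemma mdeg_root a : mdeg (root a) < root_bound.
Proof.
rewrite ltnS mdegE; apply: leq_sum => x _; rewrite mnmE big_mkcond /=.
by apply: leq_sum => j _; case: ifP => // _; rewrite geq_minr.
Qed.

(** The roots of the boxes that partition the monomials of [J]. *)
Definition is_root a : bool := in_ideal a && (root a == a).

Lemma root_root a : in_ideal a -> root (root a) = root a.
Proof. by move=> aI; apply: box_root => //; apply: root_in_box. Qed.

Lemma root_is_root a : in_ideal a -> is_root (root a).
Proof.
move=> aI; rewrite /is_root root_root // eqxx andbT.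
exact: box_ideal (root_in_box a).
Qed.

Lemma frozen_root a : in_ideal a -> frozen (root a) = frozen a.
Proof. by move=> aI; apply: box_frozen => //; apply: root_in_box. Qed.

Section Polynomials.

Local Open Scope ring_scope.
Variable K : fieldType.
Implicit Types (f g : {mpoly K[n]}) (k : 'X_{1..n}).

(** The part of [f] supported on the box of the root [k], divided by the
    monomial [k]. *)
Definition box_coef f k : {mpoly K[n]} :=
  \sum_(a <- msupp f | root a == k) f@_a *: 'X_[a - k].

Lemma in_varsD (Z : {set 'I_n}) f g :
  in_vars Z f -> in_vars Z g -> in_vars Z (f + g).
Proof.
move=> hf hg a /msuppD_le; rewrite mem_cat => /orP[]; [exact: hf|exact: hg].
Qed.

Lemma in_vars0 (Z : {set 'I_n}) : in_vars Z (0 : {mpoly K[n]}).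
Proof. by move=> a; rewrite mcoeff_msupp mcoeff0 eqxx. Qed.

Lemma box_coef_in_vars f k :
    (forall a, a \in msupp f -> in_ideal a) ->
  in_vars (~: frozen k) (box_coef f k).
Proof.
move=> fI; rewrite /box_coef big_seq_cond.
elim/big_ind: _ => [|g h|a /andP[af /eqP rk]]; [exact: in_vars0|exact: in_varsD|].
move=> b /msuppZ_le; rewrite msuppX inE => /eqP-> x; rewrite inE negbK -rk.
by rewrite (frozen_root (fI _ af)) => xf; rewrite mnmBE root_frozen ?subnn.
Qed.

Lemma box_decomposition f :
    (forall a, a \in msupp f -> in_ideal a) ->
  f = \sum_(k : 'X_{1..n < root_bound} | is_root k) box_coef f k * 'X_[k].
Proof.
move=> fI; rewrite [LHS]mpolyE.
under [RHS]eq_bigr do rewrite /box_coef big_distrl big_mkcond /=.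
rewrite exchange_big /= big_seq [RHS]big_seq; apply: eq_bigr => a af.
rewrite (bigD1 (BMultinom (mdeg_root a))) /=; last exact/root_is_root/fI.
rewrite eqxx -scalerAl -mpolyXD submK ?root_le // big1 ?addr0 //.
move=> k /andP[_ ne]; case: eqP => // e; case/eqP: ne.
by apply/val_inj; rewrite /= e.
Qed.

Lemma in_box_shift k b :
    is_root k -> (forall x, x \notin ~: frozen k -> b x = 0%N) ->
  root (b + k)%MM = k.
Proof.
case/andP=> kI /eqP rk hb; rewrite -[RHS]rk; apply: box_root => //.
rewrite /in_box rk; apply/andP; split.
  by apply/mnm_lepP => x; rewrite mnmDE leq_addl.
by apply/forall_inP => x xf; rewrite mnmDE hb // in_setC xf.
Qed.

Lemma box_independent (g : 'X_{1..n < root_bound} -> {mpoly K[n]}) :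
    (forall k : 'X_{1..n < root_bound},
       is_root k -> in_vars (~: frozen k) (g k)) ->
    \sum_(k : 'X_{1..n < root_bound} | is_root k) g k * 'X_[k] = 0 ->
  forall k : 'X_{1..n < root_bound}, is_root k -> g k = 0.
Proof.
move=> gZ sum0 k kR; apply/mpolyP => b; rewrite mcoeff0.
apply/eqP/negPn/negP; rewrite -mcoeff_msupp => bg.
have rbk := in_box_shift kR (gZ k kR b bg).
have := congr1 (mcoeff (b + k)%MM) sum0.
rewrite addmC raddf_sum (bigD1 k) //= mcoeffMX big1 => [|l /andP[lR lk]].
  by rewrite addr0 mcoeff0; apply/eqP; rewrite -mcoeff_msupp.
apply: memN_msupp_eq0; rewrite (perm_mem (msuppMX _ _)).
apply/mapP=> -[d dg e]; case/eqP: lk; apply/val_inj => /=.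
by rewrite -rbk addmC e addmC (in_box_shift lR (gZ l lR d dg)).
Qed.

End Polynomials.

End Boxes.

(** * Koszul syzygies and their leading coefficients *)

Section KoszulSyzygies.

Variables (K : fieldType) (n m : nat) (u : 'I_m -> 'X_{1..n}).
Local Notation M := (koszul K n m).
Local Notation d := (@koszul_diff K n m u).
Implicit Types (A B C : {set 'I_m}) (i j l : 'I_m) (f g : M).

(** The basis element [e_B]. *)
Definition basis B : M := [ffun A => (A == B)%:R].

(** The weight by which the basis elements are ordered. *)
Definition weight A : nat := (\sum_(i in A) i)%N.

(** The least element of [C], or [m] if [C] is empty. *)
Definition low C : nat := \big[minn/m]_(i in C) i.

Lemma low_le C i : i \in C -> (low C <= i)%N.
Proof. by move=> iC; rewrite -leEnat /low -minEnat; apply: bigmin_le_cond. Qed.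

Lemma low_ge C k : (forall i, i \in C -> k <= i)%N -> (k <= m)%N -> (k <= low C)%N.
Proof. by move=> kC km; rewrite -leEnat /low -minEnat; apply: le_bigmin. Qed.

Lemma low_le_m C : (low C <= m)%N.
Proof. by rewrite -leEnat /low -minEnat; apply: bigmin_le_id. Qed.

Lemma low_notin C j : (j < low C)%N -> j \notin C.
Proof. by move=> jC; apply/negP => /low_le; rewrite leqNgt jC. Qed.

Lemma low_card C : (low C + #|C| <= m)%N.
Proof.
pose w := widen_ord (low_le_m C).
have cw : #|w @: setT| = low C.
  by rewrite card_imset ?cardsT ?card_ord // => x y [/val_inj].
rewrite -{1}cw -cardsUI; have -> : w @: setT :&: C = set0.
  apply/setP => i; rewrite !inE; apply/negP => /andP[/imsetP[x _ ->]].
  by apply/negP/low_notin; rewrite /= ltn_ord.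
by rewrite cards0 addn0 -[leqRHS]card_ord max_card.
Qed.

Lemma weight_setU1 j A : j \notin A -> weight (j |: A) = (j + weight A)%N.
Proof. by move=> jA; rewrite /weight big_setU1. Qed.

(** The coefficient of [e_A] in [f]. *)
Definition coef f A : {mpoly K[n]} := f A.

Lemma koszulP f g : (forall A, coef f A = coef g A) -> f = g.
Proof. by move=> fg; apply/ffunP. Qed.

Lemma coef0 A : coef 0 A = 0.
Proof. exact: ffunE. Qed.

Lemma coefD f g A : coef (f + g) A = coef f A + coef g A.
Proof. exact: ffunE. Qed.

Lemma coefZ (a : {mpoly K[n]}) f A : coef (a *: f) A = a * coef f A.
Proof. exact: ffunE. Qed.

Lemma coef_sum (I : Type) (r : seq I) (P : pred I) (F : I -> M) A :
  coef (\sum_(x <- r | P x) F x) A = \sum_(x <- r | P x) coef (F x) A.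
Proof. by apply: (big_morph (coef^~ A)) => [f g|]; rewrite ?coefD ?coef0. Qed.

Lemma coef_basis B A : coef (basis B) A = (A == B)%:R.
Proof. exact: ffunE. Qed.

Lemma coef_kdiff f B : coef (d f) B = \sum_(j | j \notin B)
  ((-1) ^+ #|[set i in B | (i < j)%N]| * 'X_[K, u j]) * coef f (j |: B).
Proof. exact: ffunE. Qed.

Lemma koszul_homog_coef f :
    (exists a : 'X_{1..n}, forall A (b : 'X_{1..n}),
       b \in msupp (coef f A) -> (b + \sum_(j in A) u j)%MM = a) ->
  koszul_homog u f.
Proof. by []. Qed.

Lemma kdiff0 : d 0 = 0.
Proof.
by apply: koszulP => B; rewrite coef_kdiff coef0 big1 // => j _; rewrite coef0 mulr0.
Qed.

Lemma kdiffD f g : d (f + g) = d f + d g.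
Proof.
apply: koszulP => B; rewrite coefD !coef_kdiff -big_split; apply: eq_bigr => j _ /=.
by rewrite coefD mulrDr.
Qed.

Lemma kdiffZ (a : {mpoly K[n]}) f : d (a *: f) = a *: d f.
Proof.
apply: koszulP => B; rewrite coefZ !coef_kdiff big_distrr; apply: eq_bigr => j _ /=.
by rewrite coefZ mulrCA.
Qed.

Lemma sign_below B j l : j \notin B -> (j < l)%N ->
  #|[set i in j |: B | (i < l)%N]| = #|[set i in B | (i < l)%N]|.+1.
Proof.
move=> jB jl; have jB' : j \notin [set i in B | (i < l)%N] by rewrite inE (negPf jB).
rewrite -[RHS]add1n -[1%N]/(nat_of_bool true) -{1}jB' -cardsU1.
apply: eq_card => i; rewrite !inE.
by case: eqP => //= ->; rewrite jl.
Qed.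

Lemma sign_above B j l : (j < l)%N ->
  #|[set i in l |: B | (i < j)%N]| = #|[set i in B | (i < j)%N]|.
Proof.
move=> jl; apply: eq_card => i; rewrite !inE; case: eqP => //= ->.
by rewrite ltnNge ltnW //= andbF.
Qed.

Lemma sign_low B j :
  (forall i, i \in B -> j <= i)%N -> #|[set i in B | (i < j)%N]| = 0%N.
Proof.
move=> h; apply/eqP; rewrite cards_eq0 -subset0; apply/subsetP => i.
by rewrite !inE => /andP[/h]; rewrite leqNgt => /negPf->.
Qed.

(** Pairing the terms that remove [j] and [l] in the two possible orders shows
    [d (d f) = 0] in every characteristic. *)
Lemma kdiff_kdiff f : d (d f) = 0.
Proof.
apply: koszulP => B; rewrite coef_kdiff coef0.
pose t j l : {mpoly K[n]} :=
  ((-1) ^+ #|[set i in B | (i < j)%N]| * 'X_[K, u j]) *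
  (((-1) ^+ #|[set i in j |: B | (i < l)%N]| * 'X_[K, u l]) *
   coef f (l |: (j |: B))).
have tN j l : j \notin B -> l \notin B -> (j < l)%N -> t j l + t l j = 0.
  move=> jB lB jl; rewrite /t sign_below // sign_above // exprS setUCA.
  by ring.
pose Q j l := (j \notin B) && (l \notin B).
transitivity (\sum_j \sum_(l | Q j l && (j != l)) t j l).
  rewrite big_mkcond; apply: eq_bigr => j _; case: ifP => jB; last first.
    by rewrite big_pred0 // => l; rewrite /Q jB.
  rewrite coef_kdiff big_distrr /=; apply: eq_bigl => l.
  by rewrite /Q jB !inE negb_or andbC eq_sym.
transitivity (\sum_j \sum_(l | Q j l && (j < l)%N) (t j l + t l j)).
  under [RHS]eq_bigr do rewrite big_split.
  rewrite big_split /= [X in _ + X](exchange_big_dep xpredT) //= -big_split /=.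
  apply: eq_bigr => j _; rewrite (bigID (fun l => (j < l)%N)) /=; congr (_ + _).
    apply: eq_bigl => l; rewrite -andbA; congr (_ && _).
    by rewrite -val_eqE /= neq_ltn; case: ltngtP.
  apply: eq_bigl => l; rewrite /Q -val_eqE /= neq_ltn.
  by case: (j \notin B); case: (l \notin B); case: ltngtP.
by rewrite big1 // => j _; rewrite big1 // => l /andP[/andP[jB lB] jl]; apply: tN.
Qed.

Lemma coef_kdiff_basis B A l : l \notin A -> l |: A = B ->
  coef (d (basis B)) A = (-1) ^+ #|[set i in A | (i < l)%N]| * 'X_[K, u l].
Proof.
move=> lA <-; rewrite coef_kdiff (bigD1 l) //= coef_basis eqxx mulr1.
rewrite big1 ?addr0 // => j /andP[jA jl]; rewrite coef_basis.
case: eqP => [e|_]; last by rewrite mulr0.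
have : j \in l |: A by rewrite -e setU11.
by rewrite !inE (negPf jA) (negPf jl).
Qed.

Lemma coef_kdiff_basis0 B A :
  (forall l, l \notin A -> l |: A != B) -> coef (d (basis B)) A = 0.
Proof.
move=> h; rewrite coef_kdiff big1 // => j jA.
by rewrite coef_basis (negPf (h j jA)) mulr0.
Qed.

Lemma syzygy0 p : koszul_syzygy u p (0 : M).
Proof.
split=> [A _|]; first exact: coef0.
case: p => [|p]; last exact: kdiff0.
exists (fun=> 0); rewrite big1 => [|j _]; [exact: coef0|exact: mul0r].
Qed.

Lemma syzygyD p f g :
  koszul_syzygy u p f -> koszul_syzygy u p g -> koszul_syzygy u p (f + g).
Proof.
case=> fp hf [gp hg]; split=> [A Ap|].
  by rewrite [LHS]coefD /coef fp // gp // addr0.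
case: p {fp gp} hf hg => [|p] hf hg; last by rewrite kdiffD hf hg addr0.
case: hf hg => a ha [b hb]; exists (fun j => a j + b j).
rewrite [LHS]coefD /coef ha hb -big_split; apply: eq_bigr => j _ /=.
by rewrite mulrDl.
Qed.

Lemma syzygyZ p (a : {mpoly K[n]}) f :
  koszul_syzygy u p f -> koszul_syzygy u p (a *: f).
Proof.
case=> fp hf; split=> [A Ap|]; first by rewrite [LHS]coefZ /coef fp // mulr0.
case: p {fp} hf => [|p] hf; last by rewrite kdiffZ hf scaler0.
case: hf => b hb; exists (fun j => a * b j).
rewrite [LHS]coefZ /coef hb big_distrr; apply: eq_bigr => j _ /=.
by rewrite mulrA.
Qed.

Lemma syzygy_sum p (I : Type) (r : seq I) (P : pred I) (F : I -> M) :
    (forall x, P x -> koszul_syzygy u p (F x)) ->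
  koszul_syzygy u p (\sum_(x <- r | P x) F x).
Proof.
move=> h; apply: big_ind => //; [exact: syzygy0|exact: syzygyD].
Qed.

Lemma kdiff_basis_syzygy j C : j \notin C ->
  koszul_syzygy u #|C| (d (basis (j |: C))).
Proof.
move=> jC; split=> [A AC|].
  apply: coef_kdiff_basis0 => l lA; apply: contraNneq AC => e.
  by have := congr1 (fun X : {set 'I_m} => #|X|) e; rewrite /= !cardsU1 lA jC => /addnI->.
case E: #|C| => [|p]; last exact: kdiff_kdiff.
exists (fun i => (i == j)%:R); rewrite [LHS](@coef_kdiff_basis _ _ j) ?inE //; last first.
  by rewrite (cards0_eq E).
rewrite (bigD1 j) //= eqxx big1 => [|i /negPf->]; last by rewrite mul0r.
by rewrite addr0 sign_low // => i; rewrite inE.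
Qed.

Section Regular.

Hypothesis hu : regular_sequence (fun i : 'I_m => 'X_[K, u i]).

(** The leading coefficient of a syzygy at [e_C] lies in the ideal generated by
    the [u_j] with [j] below [C]. *)
Lemma syzygy_top_coef p f C :
    koszul_syzygy u p f -> #|C| = p ->
    (forall A, (weight C < weight A)%N -> coef f A = 0) ->
  generated (fun j => j < low C)%N (fun j => 'X_[K, u j]) (coef f C).
Proof.
move=> [_ hf] Cp top; case: p Cp hf => [|p] Cp hf.
  case: hf => c hc; exists c; rewrite (cards0_eq Cp) [LHS]hc.
  by apply: eq_bigl => j; rewrite /low big_set0 ltn_ord.
have /card_gt0P[i1 i1C] : (0 < #|C|)%N by rewrite Cp.
case: (arg_minnP (P := mem C) (fun i : 'I_m => nat_of_ord i) i1C) => i0 i0C min0.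
have lowC : low C = i0.
  by apply/eqP; rewrite eqn_leq low_le // low_ge // ltnW.
have [reg _] := hu; rewrite lowC; apply: reg.
pose B := C :\ i0; have i0B : i0 \notin B by rewrite !inE eqxx.
have CE : i0 |: B = C by rewrite setD1K.
have := congr1 (coef^~ B) hf; rewrite /= coef0 coef_kdiff (bigD1 i0) //= CE.
rewrite sign_low => [|i]; last by rewrite !inE => /andP[_ /min0].
rewrite expr0 mul1r => /eqP; rewrite addr_eq0 => /eqP->.
exists (fun j => if j \notin B then
  - ((-1) ^+ #|[set i in B | (i < j)%N]| * coef f (j |: B)) else 0).
rewrite -sumrN (bigID (fun j => j < i0)%N) /= [X in _ + X]big1 ?addr0.
  rewrite big_mkcond [RHS]big_mkcond; apply: eq_bigr => j _ /=.
  case: (ltnP j i0) => ji; rewrite ?andbF // andbT.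
  rewrite -val_eqE /= ltn_eqF // andbT; case: ifP => jB; last by rewrite mul0r.
  by ring.
(* For [j > i0] the set [j |: B] is heavier than [C]. *)
move=> j /andP[/andP[jB ji]]; rewrite -leqNgt => le; rewrite top ?mulr0 ?oppr0 //.
rewrite weight_setU1 // -CE weight_setU1 // ltn_add2r ltn_neqAle le andbT.
by rewrite eq_sym.
Qed.

End Regular.

(** * Generators of the Stanley spaces *)

Section Generators.

Local Notation index := ({set 'I_m} * 'X_{1..n < root_bound u})%type.
Implicit Types (s : index).

(** The pairs of a [p]-element set [C] and the root of a box of the ideal
    generated by the [u_j] with [j] below [C]. *)
Definition stanley_index p : {set index} :=
  [set s : index | (#|s.1| == p) && is_root u (low s.1) s.2].

(** The lift [(k / u_j) d e_(j |: C)] of the root [k], for some [j] below [C]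
    such that [u_j] divides [k].  Such a [j] exists for every pair in
    [stanley_index p]; the default value [0] is not used for those. *)
Definition generator s : M :=
  if [pick j : 'I_m | (j < low s.1)%N && (u j <= s.2)%MM] is Some j
  then 'X_[s.2 - u j] *: d (basis (j |: s.1)) else 0.

Definition generator_vars s : {set 'I_n} := ~: frozen u (low s.1) s.2.

Lemma generatorE p s : s \in stanley_index p ->
  exists j, [/\ (j < low s.1)%N, (u j <= s.2)%MM &
                generator s = 'X_[s.2 - u j] *: d (basis (j |: s.1))].
Proof.
rewrite inE /generator => /andP[_ /andP[/existsP[j0 h0] _]].
by case: pickP => [j /andP[jl js]|/(_ j0)]; [exists j|rewrite h0].
Qed.

Lemma generator_syzygy p s : s \in stanley_index p -> koszul_syzygy u p (generator s).
Proof.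
move=> sp; have [j [jl _ ->]] := generatorE sp.
move: sp; rewrite inE => /andP[/eqP<- _].
exact/syzygyZ/kdiff_basis_syzygy/low_notin.
Qed.

Lemma generator_homog p s : s \in stanley_index p -> koszul_homog u (generator s).
Proof.
move=> sp; have [j [jl js ->]] := generatorE sp.
apply: koszul_homog_coef; exists (s.2 - u j + \sum_(i in j |: s.1) u i)%MM => A a.
rewrite coefZ.
case: (pickP (fun l => (l \notin A) && (l |: A == j |: s.1))) => [l /andP[lA /eqP e]|no].
  rewrite (coef_kdiff_basis lA e) mulrCA -mpolyXD -signr_odd.
  have -> : a \in msupp ((-1) ^+ odd #|[set i in A | (i < l)%N]| *
     'X_[K, (s.2 - u j + u l)%MM]) = (a == (s.2 - u j + u l)%MM).
    case: (odd _); rewrite ?expr0 ?expr1 ?mul1r ?mulN1r.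
      by rewrite (perm_mem (msuppN _)) msuppX inE.
    by rewrite msuppX inE.
  by move=> /eqP->; rewrite -e big_setU1 // addmA.
rewrite coef_kdiff_basis0 ?mulr0 => [|l lA]; first by rewrite mcoeff_msupp mcoeff0 eqxx.
by have := no l; rewrite lA /= => ->.
Qed.

Lemma coef_generator p s : s \in stanley_index p -> coef (generator s) s.1 = 'X_[s.2].
Proof.
move=> sp; have [j [jl js ->]] := generatorE sp.
rewrite coefZ (@coef_kdiff_basis _ _ j) ?low_notin //.
rewrite sign_low => [|i /low_le li]; last exact: leq_trans (ltnW jl) li.
by rewrite expr0 mul1r -mpolyXD submK.
Qed.

Lemma coef_generator_lower p s A : s \in stanley_index p -> A != s.1 ->
  (weight s.1 <= weight A)%N -> coef (generator s) A = 0.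
Proof.
move=> sp As wA; have [j [jl js ->]] := generatorE sp.
rewrite coefZ coef_kdiff_basis0 ?mulr0 // => l lA; apply: contraNneq As => e.
have js1 := low_notin jl.
have lj : l = j.
  apply/eqP; have : l \in j |: s.1 by rewrite -e setU11.
  rewrite !inE => /predU1P[->//|/low_le ll].
  have := congr1 weight e; rewrite !weight_setU1 //.
  by move: (leq_trans jl ll) wA; lia.
by rewrite -(setU1K lA) e lj setU1K.
Qed.

(** The coefficient at [e_A] of a combination of generators only involves the
    generators over [A], provided that those of larger weight do not occur. *)
Lemma coef_generator_sum p (g : index -> {mpoly K[n]}) A : #|A| = p ->
    (forall s, s \in stanley_index p -> (weight A < weight s.1)%N -> g s = 0) ->
  coef (\sum_(s in stanley_index p) g s *: generator s) A =
  \sum_(k : 'X_{1..n < root_bound u} | is_root u (low A) k) g (A, k) * 'X_[k].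
Proof.
move=> Ap g0; rewrite coef_sum (bigID (fun s => s.1 == A)) /=.
rewrite [X in _ + X]big1 ?addr0; last first.
  move=> s /andP[sp sA]; rewrite coefZ; case: (ltnP (weight A) (weight s.1)) => w.
    by rewrite g0 // mul0r.
  by rewrite (coef_generator_lower sp) ?mulr0 // eq_sym.
rewrite (reindex_onto (fun k => (A, k)) snd) /=; last by case=> B k /= /andP[_ /eqP->].
apply: eq_big => [k|k /andP[/andP[sp _] _]]; first by rewrite inE /= Ap !eqxx !andbT.
by rewrite coefZ (coef_generator sp).
Qed.

End Generators.

End KoszulSyzygies.

(** * The Stanley decomposition of the syzygy module *)

Section Decomposition.

Variables (K : fieldType) (n m : nat) (u : 'I_m -> 'X_{1..n}).
Hypothesis hu : regular_sequence (fun i : 'I_m => 'X_[K, u i]).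
Local Notation M := (koszul K n m).
Local Notation index := ({set 'I_m} * 'X_{1..n < root_bound u})%type.
Implicit Types (s : index) (p : nat).

Let u_disjoint := regular_monomials_disjoint hu.

(** By induction on a strict bound [w] for the weights occurring in [f]: subtract
    the combination of generators [f1] that has the same coefficients as [f] in
    the largest possible weight. *)
Lemma generator_span p (f : M) : koszul_syzygy u p f ->
  exists2 g : index -> {mpoly K[n]},
    forall s, s \in stanley_index u p -> in_vars (generator_vars s) (g s)
    & f = \sum_(s in stanley_index u p) g s *: generator K s.
Proof.
move=> fZ.
have [w fw] : exists w, forall A, (w <= weight A)%N -> coef f A = 0.
  exists (\max_(A : {set 'I_m}) weight A).+1 => A.
  by rewrite ltnNge leq_bigmax.
elim: w f fZ fw => [|w IH] f fZ fw.
  exists (fun=> 0) => [s _|]; first exact: in_vars0.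
  rewrite big1 => [|s _]; last exact: scale0r.
  by apply: koszulP => A; rewrite fw // coef0.
pose g s := if weight s.1 == w then box_coef u (low s.1) (coef f s.1) s.2 else 0.
have fI (A : {set 'I_m}) : #|A| = p -> weight A = w ->
    forall a, a \in msupp (coef f A) -> in_ideal u (low A) a.
  move=> Ap Aw a af; have fA : forall B, (weight A < weight B)%N -> coef f B = 0.
    by move=> B; rewrite Aw => /fw.
  have [j jA ja] := msupp_generated (syzygy_top_coef hu fZ Ap fA) af.
  by apply/existsP; exists j; rewrite jA.
have gZ s : s \in stanley_index u p -> in_vars (generator_vars s) (g s).
  rewrite inE /g => /andP[/eqP sp _]; case: eqP => [sw|_]; last exact: in_vars0.
  by apply: (box_coef_in_vars u_disjoint (low_le_m _)); apply: fI.
pose f1 := \sum_(s in stanley_index u p) g s *: generator K s.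
have f1Z : koszul_syzygy u p f1.
  by apply: syzygy_sum => s sp; apply/syzygyZ/generator_syzygy/sp.
have f1f (A : {set 'I_m}) : #|A| = p -> (w <= weight A)%N -> coef f1 A = coef f A.
  move=> Ap wA; rewrite coef_generator_sum //; last first.
    by move=> s _ As; rewrite /g gtn_eqF // (leq_ltn_trans wA).
  rewrite /g /=; case: eqP => [Aw|/eqP ne].
    by rewrite -box_decomposition ?low_le_m //; apply: fI.
  rewrite big1 => [|k _]; last exact: mul0r.
  by rewrite fw // ltn_neqAle eq_sym ne.
have [||h hZ he] := IH (f + (-1) *: f1).
- exact/syzygyD/syzygyZ.
- move=> A wA; rewrite coefD coefZ mulN1r; have [Ap|/eqP Ap] := eqVneq #|A| p.
    by rewrite f1f // subrr.
  case: fZ f1Z => fZ _ [f1Z _].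
  by rewrite /coef fZ ?f1Z ?subrr //; apply/eqP.
exists (fun s => g s + h s) => [s sp|]; first by apply: in_varsD; [exact: gZ|exact: hZ].
transitivity (f1 + (f + (-1) *: f1)); first by rewrite scaleN1r addrC subrK.
by rewrite he -big_split; apply: eq_bigr => s _ /=; rewrite scalerDl.
Qed.

(** Look at the largest weight for which some coefficient is nonzero. *)
Lemma generator_independent p (g : index -> {mpoly K[n]}) :
    (forall s, s \in stanley_index u p -> in_vars (generator_vars s) (g s)) ->
    \sum_(s in stanley_index u p) g s *: generator K s = 0 ->
  forall s, s \in stanley_index u p -> g s = 0.
Proof.
move=> gZ sum0 s0 s0p; apply/eqP/negPn/negP => gs0.
pose P s := (s \in stanley_index u p) && (g s != 0).
have Ps0 : P s0 by rewrite /P s0p.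
case: (arg_maxnP (fun s => weight s.1) Ps0) => s /andP[sp gs] smax.
case/eqP: gs; case: s sp smax => A k /=; rewrite inE /= => /andP[/eqP Ap kR] smax.
apply: (box_independent u_disjoint (low_le_m A) (g := fun k => g (A, k))) kR.
  by move=> l lR; apply: (gZ (A, l)); rewrite inE /= Ap eqxx.
rewrite -(@coef_generator_sum _ _ _ _ p g A) ?sum0 ?coef0 // => s sp As.
apply/eqP/negPn/negP => gs; have := smax s.
by rewrite /P sp gs => /(_ isT); rewrite leqNgt As.
Qed.

Lemma scale_generator_inj p s (g : {mpoly K[n]}) :
  s \in stanley_index u p -> g *: generator K s = 0 -> g = 0.
Proof.
move=> sp /(congr1 (fun f : M => coef f s.1)) /=.
rewrite coefZ (coef_generator K sp) coef0 => /eqP.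
by rewrite mulf_eq0 -[X in _ || X]msupp_eq0 msuppX orbF => /eqP.
Qed.

Lemma koszul_stanley_decomposition p :
  stanley_decomposition (@koszul_homog K n m u) (@koszul_syzygy K n m u p)
    (fun i : 'I_#|stanley_index u p| => generator K (enum_val i))
    (fun i => generator_vars (enum_val i)).
Proof.
have ip (i : 'I_#|stanley_index u p|) : enum_val i \in stanley_index u p.
  exact: enum_valP.
split.
- move=> i; split; first exact: generator_syzygy (ip i).
  exact: generator_homog (ip i).
- by move=> i g _; apply: scale_generator_inj (ip i).
- move=> v; split=> [/generator_span[g gZ ->]|[w wZ ->]].
    exists (fun i => g (enum_val i) *: generator K (enum_val i)).
      by move=> i; exists (g (enum_val i)) => //; apply: gZ.
    by rewrite big_enum_val.
  apply: syzygy_sum => i _; have [g _ ->] := wZ i.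
  exact/syzygyZ/generator_syzygy/ip.
move=> w wZ sum0.
have [g gZ gw] := fin_all_exists2 wZ.
move=> i; have s0p := ip i.
pose h s := g (enum_rank_in s0p s).
have hg j : h (enum_val j) = g j by rewrite /h enum_valK_in.
rewrite gw -hg (@generator_independent p h) ?scale0r // => [s sp|].
  by rewrite -{1}(enum_rankK_in s0p sp); apply: gZ.
rewrite big_enum_val -[RHS]sum0; apply: eq_bigr => j _.
by rewrite gw hg.
Qed.

(** At most [(low C)./2] variables are frozen, and [low C <= m - p]. *)
Lemma generator_vars_card p s : s \in stanley_index u p ->
  (n - (m - p)./2 <= #|generator_vars s|)%N.
Proof.
rewrite inE => /andP[/eqP sp /andP[sI _]].
have := frozen_count (low_le_m s.1) sI; have := low_card s.1.
rewrite /generator_vars; have := cardsC (frozen u (low s.1) s.2).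
rewrite card_ord sp; lia.
Qed.

Lemma syzygy_eq0 p (f : M) : (m < p)%N -> koszul_syzygy u p f -> f = 0.
Proof.
move=> mp [fp _]; apply: koszulP => A; rewrite coef0 /coef fp //.
by rewrite ltn_eqF // (leq_ltn_trans _ mp) // -[leqRHS]card_ord max_card.
Qed.

End Decomposition.

Lemma sdepth_ge (K : fieldType) (n : nat) (M : lmodType {mpoly K[n]})
    (homogeneous N : M -> Prop) (r : nat) (v : 'I_r -> M)
    (Z : 'I_r -> {set 'I_n}) (e : nat) :
    stanley_decomposition homogeneous N v Z -> (e <= n)%N ->
    (forall i, e <= #|Z i|)%N ->
  (e <= sdepth homogeneous N)%N.
Proof.
move=> dec en eZ; have Zn : (stanley_depth Z <= n)%N.
  by rewrite -leEnat /stanley_depth -minEnat; apply: bigmin_le_id.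
apply: (@leq_trans (stanley_depth Z)).
  by rewrite -leEnat /stanley_depth -minEnat; apply: le_bigmin.
rewrite /sdepth -ltnS in Zn *.
apply: (@leq_bigmax_cond _ _ (fun d : 'I_n.+1 => nat_of_ord d) (Ordinal Zn)).
by apply/asboolP; exists r, v, Z.
Qed.

Theorem proposition2p4 (K : fieldType) (n m : nat) (u : 'I_m -> 'X_{1..n})
    (hu : regular_sequence (fun i : 'I_m => 'X_[K, u i])) (p : nat) :
  free_submodule (@koszul_syzygy K n m u p) \/
  n%:Z - ((m%:Z - p%:Z) %/ 2)%Z
    <= (sdepth (@koszul_homog K n m u) (@koszul_syzygy K n m u p))%:Z.
Proof.
case: (ltnP m p) => [mp|pm].
  left; exists 0, (fun=> 0); split=> [f|c _ []//]; split.
    by move/(syzygy_eq0 mp) => ->; exists (fun=> 0); rewrite big_ord0.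
  by case=> c ->; rewrite big_ord0; apply: syzygy0.
right; have := sdepth_ge (koszul_stanley_decomposition hu p)
  (leq_subr (m - p)./2 n) (fun i => generator_vars_card (enum_valP i)).
lia.
Qed.
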